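(* Let $\mathcal K(t)\subset\Omega$, $t\ge0$, be a family of measurable sets with $X(t;s,\mathcal K(s))\subset\mathcal K(t)$ for all $0\le s\le t$. Let $\Phi\in C^1(\mathbb R_{\ge0}\times\overline\Omega)$ and $a_d\in\mathbb R$ be such that $V_d(t):=\{x\in\Omega:\Phi(t,x)\le a_d\}$ is nonempty for all $t\ge0$. Assume that there exist constants $\gamma>0$, $\Phi_{\max}>a_d$, $\sigma_{\min}>0$ and representatives of $u$ and $\sigma$ such that, for every $t\ge0$, $$\Phi(t,x)\le\Phi_{\max},\quad x\in\mathcal K(t),$$ $$D_u\Phi(t,x):=\partial_t\Phi(t,x)+u(t,x)\cdot\nabla\Phi(t,x)\le-\gamma,\quad x\in\mathcal K(t)\setminus V_d(t),$$ $$\sigma(t,x)\ge\sigma_{\min},\quad x\in V_d(t)\cap\mathcal K(t).$$ Then every characteristic starting in $\mathcal K(t)$ enters $V_d(s)\cap\mathcal K(s)$ within the uniform time $$T_{\mathrm{in}}:=\frac{\Phi_{\max}-a_d}{\gamma}.$$ More precisely, for every $t\ge0$ and every $x\in\mathcal K(t)$, $$X(s;t,x)\in V_d(s)\cap\mathcal K(s)\qquad\text{for all } s\ge t+T_{\mathrm{in}}.$$ Consequently, for every $T>T_{\mathrm{in}}$, every $t\ge 0$ and every $x\in\mathcal K(t)$, $$\int_t^{t+T}\sigma(s,X(s;t,x))\,ds\ge\sigma_{\min}(T-T_{\mathrm{in}}).$$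
   Context: $\Omega\subset\mathbb R^m$ ($m\ge1$) is a bounded domain with $C^2$ boundary and outward unit normal $n$; $\mathbb R_{\ge0}=[0,+\infty)$. The velocity field satisfies $u\in L^\infty_{\mathrm{loc}}(\mathbb R_{\ge0};W^{1,\infty}(\Omega;\mathbb R^m))$, $\nabla\cdot u\in L^\infty(\mathbb R_{\ge0}\times\Omega)$ and $u(t,\cdot)\cdot n=0$ on $\partial\Omega$ (trace sense) for a.e. $t\ge0$. The localization function satisfies $\sigma\in L^\infty(\mathbb R_{\ge0}\times\Omega)$, $\sigma\ge0$ a.e.; its chosen representative is a bounded nonnegative Borel function. $X(s;t,x)$ is the (unique, Carathéodory) characteristic flow: $\frac{d}{ds}X(s;t,x)=u(s,X(s;t,x))$, $X(t;t,x)=x$; each $X(s;t,\cdot)$ is a Lipschitz homeomorphism of $\overline\Omega$ onto itself mapping $\Omega$ onto $\Omega$. *)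

(* Defs.v *)
From HB Require Import structures.
From mathcomp Require Import all_boot all_order all_algebra.
From mathcomp Require Import all_classical all_reals all_analysis.

Set Implicit Arguments.
Unset Strict Implicit.
Unset Printing Implicit Defensive.
Import Order.TTheory GRing.Theory Num.Theory.
Import numFieldNormedType.Exports.

Local Open Scope classical_set_scope.
Local Open Scope ring_scope.

(* A point of the Euclidean space of dimension m.+1 >= 1 is a row vector; the
   library topology on row vectors is that of the sup norm, i.e. the usual one. *)

(* Lebesgue measure in several dimensions (the library only has dimension one):
   the outer measure defined by countable coverings by boxes; the measurable
   sets (Caratheodory) and the measure on them come from the library. *)
Section lebesgue.
Context {R : realType}.
Local Open Scope ereal_scope.

Definition box n (ab : 'rV[R]_n * 'rV[R]_n) : set 'rV[R]_n :=
  [set x | forall i, (ab.1 0 i < x 0 i <= ab.2 0 i)%R].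

Definition box_volume n (ab : 'rV[R]_n * 'rV[R]_n) : R :=
  (\prod_(i < n) Num.max 0 (ab.2 0 i - ab.1 0 i))%R.

Definition box_cover n (A : set 'rV[R]_n) : set (nat -> 'rV[R]_n * 'rV[R]_n) :=
  [set F | A `<=` \bigcup_k box (F k)].

Definition lebesgue_outer n (A : set 'rV[R]_n.+1) : \bar R :=
  ereal_inf [set \sum_(k <oo) (box_volume (F k))%:E | F in box_cover A].

Lemma box_volume_ge0 n (ab : 'rV[R]_n * 'rV[R]_n) : (0 <= box_volume ab)%R.
Proof. by apply: prodr_ge0 => i _; rewrite le_max lexx. Qed.

Lemma lebesgue_outer_ge0 n (A : set 'rV[R]_n.+1) : 0 <= lebesgue_outer A.
Proof.
apply: le_ereal_inf_tmp => x [F _ <-].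
by apply: nneseries_ge0 => k _ _; rewrite lee_fin box_volume_ge0.
Qed.

Lemma lebesgue_outer0 n : lebesgue_outer (set0 : set 'rV[R]_n.+1) = 0.
Proof.
apply/eqP; rewrite eq_le lebesgue_outer_ge0 andbT.
apply: ereal_inf_lbound; exists (fun=> (0%R, 0%R)) => //.
apply: eseries0 => k _ _; congr EFin.
by rewrite /box_volume big_ord_recl /= !mxE subrr maxxx mul0r.
Qed.

Lemma le_lebesgue_outer n :
  {homo @lebesgue_outer n : A B / A `<=` B >-> A <= B}.
Proof.
move=> A B AB; apply/ereal_inf_le_tmp => x [F BF <-].
by exists F => //; exact: subset_trans BF.
Qed.

Lemma lebesgue_outer_sigma_subadditive n :
  sigma_subadditive (@lebesgue_outer n).
Proof.
move=> A; have [[i ioo]|] := pselect (exists i, lebesgue_outer (A i) = +oo).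
  rewrite (eseries_pinfty _ _ ioo) ?leey// => k _.
  by rewrite -ltNye (lt_le_trans _ (lebesgue_outer_ge0 _)).
rewrite -forallNE => Aoo.
apply/lee_addgt0Pr => _/posnumP[e].
rewrite (le_trans _ (epsilon_trick _ _ _))//; last first.
  by move=> k; exact: lebesgue_outer_ge0.
pose v (ab : 'rV[R]_n.+1 * 'rV[R]_n.+1) := (box_volume ab)%:E.
have v0 ab : 0 <= v ab by rewrite lee_fin box_volume_ge0.
pose P k F := box_cover (A k) F /\
  \sum_(j <oo) v (F j) <= lebesgue_outer (A k) + (e%:num / (2 ^ k.+1)%:R)%:E.
have [G PG] : {G & forall k, P k (G k)}.
  apply: (@choice _ _ P) => k; rewrite /P /lebesgue_outer.
  set S := (X in ereal_inf X); move infS : (ereal_inf S) => iS.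
  case: iS infS => [r Sr|Soo|Soo].
  - have en1 : (0 < e%:num / (2 ^ k.+1)%:R)%R by [].
    have /(lb_ereal_inf_adherent en1) : ereal_inf S \is a fin_num by rewrite Sr.
    move=> [x [F AF vF] xS].
    by exists F; split => //; rewrite vF -Sr; exact/ltW.
  - by have := Aoo k; rewrite /lebesgue_outer -/S Soo.
  - suff : lbound S 0 by move/le_ereal_inf_tmp; rewrite Soo.
    by move=> /= _ [F _ <-]; apply: nneseries_ge0 => j _ _; exact: v0.
pose w (ij : nat * nat) := v (G ij.1 ij.2).
have w0 ij : 0 <= w ij by exact: v0.
apply: (@le_trans _ _ (\esum_(i in setT) w i)).
  have /card_esym/ppcard_eqP[f] := card_nat2.
  apply: ereal_inf_lbound; exists (fun k => G (f k).1 (f k).2).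
    move=> x [i _ Aix]; have [j _ Gx] := (PG i).1 _ Aix.
    by exists (f^-1%FUN (i, j)) => //=; rewrite invK ?inE.
  rewrite -[LHS]/(\sum_(k <oo) w (f k)).
  rewrite -(esum_pred_image w _ xpredT) ?[fun=> _]set_true//.
  by rewrite image_eq.
rewrite (_ : esum _ _ = \sum_(i <oo) \sum_(j <oo) w (i, j)); last first.
  pose J : nat -> set (nat * nat) := fun i => [set (i, j) | j in setT].
  rewrite (_ : setT = \bigcup_k J k); last first.
    by rewrite predeqE => -[a b]; split => // _; exists a => //; exists b.
  rewrite esum_bigcupT //=; last first.
    apply/trivIsetP => i j _ _ ij.
    rewrite predeqE => -[k l] /=; split => //= -[] [_] _ [<-{k} _].
    by move=> [l' _] [] /esym/eqP; rewrite (negbTE ij).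
  rewrite -(image_id [set: nat]) -fun_true esum_pred_image//; last first.
    by move=> k _; exact: esum_ge0.
  apply: eq_eseriesr => /= j _.
  rewrite -(esum_pred_image w (pair j) predT)//=; last first.
    by move=> ? ? _ _; exact: (@can_inj _ _ _ snd).
  by congr esum; rewrite predeqE => -[a b]; split; move=> [i _ <-]; exists i.
apply: lee_nneseries => [i _ _|i _]; first exact: nneseries_ge0.
exact: (PG i).2.
Qed.

HB.instance Definition _ n := isOuterMeasure.Build R 'rV[R]_n.+1
  (@lebesgue_outer n) (@lebesgue_outer0 n) (@lebesgue_outer_ge0 n)
  (@le_lebesgue_outer n) (@lebesgue_outer_sigma_subadditive n).

End lebesgue.

(* [lebesgue_space R n] is 'rV[R]_n.+1 with its Lebesgue-measurable sets, and
   [leb] is the (complete) Lebesgue measure on it. *)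
Notation lebesgue_space R n :=
  (caratheodory_type (@lebesgue_outer R%type n%N)).

Definition leb (R : realType) (n : nat) : set (lebesgue_space R n) -> \bar R :=
  @lebesgue_outer R n.
HB.instance Definition _ (R : realType) (n : nat) :=
  isMeasure.Build _ (lebesgue_space R n) R (@leb R n)
    (@caratheodory_measure0 _ _ (@lebesgue_outer R n))
    (@caratheodory_measure_ge0 _ _ (@lebesgue_outer R n))
    (@caratheodory_measure_sigma_additive _ _ (@lebesgue_outer R n)).

(* Subsets of and functions on time x space are handled in dimension 1 + m.+1,
   the first coordinate being time. *)
Definition time_of {R : realType} m (z : lebesgue_space R m.+1) : R :=
  lsubmx (z : 'rV[R]_(1 + m.+1)) 0 0.
Definition space_of {R : realType} m (z : lebesgue_space R m.+1) :
  'rV[R]_m.+1 := rsubmx (z : 'rV[R]_(1 + m.+1)).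

Section calculus.
Context {R : realType} {m : nat}.
Local Notation E := 'rV[R]_m.+1.

Definition dotr (x y : E) : R := \sum_i x 0 i * y 0 i.
Definition norm2 (x : E) : R := Num.sqrt (dotr x x).

Definition pd (i : 'I_m.+1) (f : E -> R) (x : E) : R :=
  'D_(delta_mx 0 i) f x.
Definition grad (f : E -> R) (x : E) : E := \row_i pd i f x.

(* [iter_pd [:: i_1; ...; i_k] f] is the iterated partial derivative
   d_{i_1} ... d_{i_k} f. *)
Definition iter_pd (s : seq 'I_m.+1) (f : E -> R) : E -> R := foldr pd f s.

Definition Ck_on (k : nat) (U : set E) (f : E -> R) : Prop :=
  forall (s : seq 'I_m.+1) (x : E), (size s <= k)%N -> U x ->
    {for x, continuous (iter_pd s f)} /\
    ((size s < k)%N -> forall i, derivable (iter_pd s f) x (delta_mx 0 i)).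

Definition boundary (Omega : set E) : set E := closure Omega `\` interior Omega.

Definition bounded_domain (Omega : set E) : Prop :=
  [/\ Omega !=set0, open Omega, connected Omega & bounded_set Omega].

(* Near [x0], Omega is the strict sublevel set {psi < 0} of a C^2 function with
   nonvanishing gradient, so that grad psi points out of Omega. *)
Definition C2_defining (Omega : set E) (x0 : E) (psi : E -> R) : Prop :=
  exists U : set E, [/\ open U, U x0, Ck_on 2 U psi,
    grad psi x0 != 0 & forall y, U y -> (Omega y <-> psi y < 0)].

Definition C2_boundary (Omega : set E) : Prop :=
  forall x, boundary Omega x -> exists psi, C2_defining Omega x psi.

Definition outward_unit_normal (Omega : set E) (n : E -> E) : Prop :=
  forall x, boundary Omega x -> exists psi, C2_defining Omega x psi /\
    n x = (norm2 (grad psi x))^-1 *: grad psi x.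

(* C_c^oo(Omega) *)
Definition test_function (Omega : set E) (phi : E -> R) : Prop :=
  (forall k, Ck_on k setT phi) /\
  exists C : set E, [/\ compact C, C `<=` Omega &
    forall x, ~ C x -> phi x = 0].

(* Membership in L^oo(Omega) with norm at most M. *)
Definition Linfty_le (Omega : set E) (M : R) (f : E -> R) : Prop :=
  measurable_fun (Omega : set (lebesgue_space R m))
    (f : lebesgue_space R m -> R) /\
  {ae (@leb R m), forall x, Omega x -> `|f x| <= M}.

Definition weak_pd (Omega : set E) (i : 'I_m.+1) (f g : E -> R) : Prop :=
  forall phi, test_function Omega phi ->
    \int[@leb R m]_(x in Omega) (f x * pd i phi x) =
    - \int[@leb R m]_(x in Omega) (g x * phi x).

Definition weak_divergence (Omega : set E) (v : E -> E) (g : E -> R) : Prop :=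
  forall phi, test_function Omega phi ->
    \int[@leb R m]_(x in Omega) dotr (v x) (grad phi x) =
    - \int[@leb R m]_(x in Omega) (g x * phi x).

(* Membership in W^{1,oo}(Omega) with norm (the maximum of the L^oo norms of
   the function and of its weak partial derivatives) at most M. *)
Definition W1infty_le (Omega : set E) (M : R) (f : E -> R) : Prop :=
  Linfty_le Omega M f /\
  forall i, exists g, Linfty_le Omega M g /\ weak_pd Omega i f g.

Definition spacetime (Omega : set E) : set (lebesgue_space R m.+1) :=
  [set z | 0 <= time_of z /\ Omega (space_of z)].

Definition measurable_spacetime (Omega : set E) (f : R -> E -> R) : Prop :=
  measurable_fun (spacetime Omega)
    (fun z : lebesgue_space R m.+1 => f (time_of z) (space_of z)).

(* L^oo(R_{>=0} x Omega) *)
Definition Linfty_spacetime (Omega : set E) (f : R -> E -> R) : Prop :=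
  measurable_spacetime Omega f /\
  exists M : R, {ae (@leb R m.+1), forall z,
    spacetime Omega z -> `|f (time_of z) (space_of z)| <= M}.

(* L^oo_loc(R_{>=0}; W^{1,oo}(Omega; R^m)), measurability being that of
   (t,x) |-> u(t,x). *)
Definition Linfty_loc_W1infty (Omega : set E) (u : R -> E -> E) : Prop :=
  (forall i, measurable_spacetime Omega (fun t x => u t x 0 i)) /\
  forall T : R, 0 < T -> exists M : R,
    {ae (@lebesgue_measure R), forall t : R, 0 <= t <= T ->
      forall i, W1infty_le Omega M (fun x => u t x 0 i)}.

(* [vf_cont]: [u] is the representative continuous up to the boundary in space,
   which exists because W^{1,oo}(Omega) functions are Lipschitz on the closure;
   it is the one whose characteristics are considered, and its restriction to
   the boundary is the trace used in [vf_tangent]. *)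
Record velocity_field (Omega : set E) (n : E -> E) (u : R -> E -> E) : Prop :=
  VelocityField {
    vf_W1infty : Linfty_loc_W1infty Omega u ;
    vf_cont : {ae (@lebesgue_measure R), forall t : R, 0 <= t ->
      {within closure Omega, continuous (u t)}} ;
    vf_div : exists g, Linfty_spacetime Omega g /\
      {ae (@lebesgue_measure R), forall t : R, 0 <= t ->
        weak_divergence Omega (u t) (g t)} ;
    vf_tangent : {ae (@lebesgue_measure R), forall t : R, 0 <= t ->
      forall x, boundary Omega x -> dotr (u t x) (n x) = 0} }.

(* The chosen representative: bounded, nonnegative and Borel. *)
Definition localization (Omega : set E) (sigma : R -> E -> R) : Prop :=
  measurable_fun
    ([set p | 0 <= p.1 /\ Omega p.2] :
      set (g_sigma_algebraType (@open (R * E)%type)))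
    (fun p : g_sigma_algebraType (@open (R * E)%type) => sigma p.1 p.2) /\
  exists M : R, forall (t : R) (x : E), 0 <= t -> Omega x -> 0 <= sigma t x <= M.

Definition absolutely_continuous_on (a b : R) (f : R -> E) : Prop :=
  forall e : R, 0 < e -> exists2 d : R, 0 < d &
    forall (N : nat) (p q : 'I_N -> R),
      (forall i, a <= p i /\ p i <= q i /\ q i <= b) ->
      (forall i j, i != j -> q i <= p j \/ q j <= p i) ->
      \sum_i (q i - p i) < d -> \sum_i `|f (q i) - f (p i)| < e.

(* [X s t x] is X(s;t,x), the position at time s of the characteristic that is
   at x at time t. *)
Record characteristic_flow (Omega : set E) (u : R -> E -> E)
    (X : R -> R -> E -> E) : Prop := CharacteristicFlow {
  cf_init : forall (t : R) (x : E), 0 <= t -> closure Omega x -> X t t x = x ;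
  cf_ac : forall (t : R) (x : E), 0 <= t -> closure Omega x ->
    forall a b : R, 0 <= a -> a <= b ->
      absolutely_continuous_on a b (fun s => X s t x) ;
  cf_ode : forall (t : R) (x : E), 0 <= t -> closure Omega x ->
    {ae (@lebesgue_measure R), forall s : R, 0 < s ->
      is_derive s 1 (fun r : R => X r t x) (u s (X s t x))} ;
  cf_lipschitz : forall s t : R, 0 <= s -> 0 <= t ->
    [lipschitz X s t x | x in closure Omega] ;
  cf_homeo : forall s t : R, 0 <= s -> 0 <= t ->
    X s t @` closure Omega = closure Omega /\
    exists2 Y : E -> E, {within closure Omega, continuous Y} &
      forall x, closure Omega x -> Y (X s t x) = x ;
  cf_inner : forall s t : R, 0 <= s -> 0 <= t -> X s t @` Omega = Omega }.

(* Phi is C^1 on R_{>=0} x closure Omega: it is continuous there and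
   differentiable in the interior, with derivatives extending continuously to
   R_{>=0} x closure Omega; [dtPhi] and [gradPhi] are these extensions. *)
Record C1_closed (Omega : set E) (Phi dtPhi : R -> E -> R)
    (gradPhi : R -> E -> E) : Prop := C1Closed {
  C1_cont : {within [set p : R * E | 0 <= p.1 /\ closure Omega p.2],
    continuous (fun p => Phi p.1 p.2)} ;
  C1_diff : forall (t : R) (x : E), 0 < t -> Omega x ->
    is_diff ((t, x) : R * E) (fun p : R * E => Phi p.1 p.2)
      (fun h : R * E => dtPhi t x * h.1 + dotr (gradPhi t x) h.2) ;
  C1_dt_cont : {within [set p : R * E | 0 <= p.1 /\ closure Omega p.2],
    continuous (fun p => dtPhi p.1 p.2)} ;
  C1_grad_cont : {within [set p : R * E | 0 <= p.1 /\ closure Omega p.2],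
    continuous (fun p => gradPhi p.1 p.2)} }.

Definition lebesgue_measurable (A : set E) : Prop :=
  measurable (A : set (lebesgue_space R m)).

End calculus.

(* Main.v *)
Require Import Defs.
From mathcomp Require Import all_boot all_order all_algebra.
From mathcomp Require Import lra.
From mathcomp Require Import all_classical all_reals all_analysis.
Import Order.TTheory GRing.Theory Num.Theory.
Import numFieldNormedType.Exports.
Local Open Scope classical_set_scope.
Local Open Scope ring_scope.

(* Along a characteristic y, the function g(s) = Phi(s, y(s)) satisfies
   g' <= - gamma almost everywhere on {g > a_d}. Integrating this does not need
   the differentiation theory of absolutely continuous functions: the null set
   where y is not differentiable has an open neighbourhood on which the total
   increment of y is arbitrarily small, and a sweep from left to right uses the
   derivative outside of it and |g r - g s| <= L (|r - s| + |y r - y s|) inside.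
   So g decreases at rate gamma from the last time at which g <= a_d, or, if
   there is none, from the initial value g(t) <= Phi_max. *)

(** * Finite families of non-overlapping intervals inside small open sets *)

(** The closed intervals may share endpoints, so the open ones are measured: they are pairwise
    disjoint, have the same lengths, and their union lies in [U]. *)
Lemma sum_length_le_measure {R : realType} (U : set R) (N : nat)
    (p q : 'I_N -> R) : measurable U ->
    (forall i, p i <= q i) -> (forall i, `[p i, q i] `<=` U) ->
    (forall i j, i != j -> q i <= p j \/ q j <= p i) ->
  ((\sum_i (q i - p i))%:E <= @lebesgue_measure R U)%E.
Proof.
move=> mU pq pqU dis.
pose F i := `]p i, q i[%classic : set R.
have mF i : measurable (F i) by exact: measurable_itv.
have mUF : measurable (\big[setU/set0]_(i < N) F i) by exact: bigsetU_measurable.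
have -> : ((\sum_i (q i - p i))%:E =
    @lebesgue_measure R (\big[setU/set0]_(i < N) F i))%E.
  rewrite measure_semi_additive_ord//; last first.
    apply/trivIsetP => i j _ _ ij; apply/seteqP; split => // x [] /=.
    rewrite /F /= !in_itv/= => /andP[pix xqi] /andP[pjx xqj].
    by case: (dis _ _ ij) => ?; lra.
  rewrite -sumEFin; apply: eq_bigr => i _.
  rewrite /F [RHS]lebesgue_measure_itv/= lte_fin; case: ltP => // qp.
  by congr EFin; apply/eqP; rewrite subr_eq0 eq_le qp; exact: pq.
apply: le_measure; rewrite ?inE//.
rewrite -bigcup_seq => x [i _ Fx].
by apply: (pqU i); exact: subset_itv_oo_cc Fx.
Qed.

(** Outer regularity, applied to a measurable null set containing [A], bounds the measure of [U]
    minus that set, and the set itself adds nothing. *)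
Lemma negligible_open_cover {R : realType} (A : set R) (d : R) :
  (@lebesgue_measure R).-negligible A -> 0 < d ->
  exists U : set R, [/\ open U, A `<=` U & (lebesgue_measure U < d%:E)%E].
Proof.
move=> [B [mB B0 AB]] d0.
have Boo : (lebesgue_measure B < +oo)%E by rewrite [X in (X < _)%E]B0 ltry.
have [U [oU BU Ud]] := lebesgue_regularity_outer mB Boo d0.
exists U; split => //; first exact: subset_trans BU.
have mU : measurable U by exact: measurable_realfun.open_measurable.
rewrite -(setDKU BU) (le_lt_trans (measureU2 _ _ _))//; first exact: measurableD.
by rewrite [X in (_ + X)%E]B0 adde0.
Qed.

Section disjoint_increments.
Context {R : realType} {V : normedZmodType R}.
Variables (U : set R) (a : R) (y : R -> V).

(* [v] is the sum of [(q - p) + |y q - y p|] over a finite family of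
   non-overlapping intervals [p, q] contained in U and in [a, s]. *)
Definition disjoint_increment (s v : R) : Prop :=
  exists N (p q : 'I_N -> R), [/\
    forall i, a <= p i /\ p i <= q i /\ q i <= s,
    forall i, `[p i, q i] `<=` U,
    forall i j, i != j -> q i <= p j \/ q j <= p i &
    v = \sum_i ((q i - p i) + `|y (q i) - y (p i)|)].

Lemma disjoint_increment0 s : disjoint_increment s 0.
Proof.
exists 0, (fun=> 0), (fun=> 0); split; try by case.
by rewrite big_ord0.
Qed.

Lemma disjoint_incrementW s r v : s <= r ->
  disjoint_increment s v -> disjoint_increment r v.
Proof.
move=> sr [N [p [q [apq pqU dis ->]]]]; exists N, p, q; split => // i.
have [ap [pq qs]] := apq i; split => //; split => //; exact: le_trans sr.
Qed.

(** Every interval of the family ends by [s], so [[s, r]] can be appended at the index [ord_max]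
    without overlap. This is how the family grows during the sweep. *)
Lemma disjoint_increment_rcons s r v : a <= s -> s <= r -> `[s, r] `<=` U ->
  disjoint_increment s v ->
  disjoint_increment r (v + ((r - s) + `|y r - y s|)).
Proof.
move=> as_ sr srU [N [p [q [apq pqU dis ->]]]].
pose app (f : 'I_N -> R) x := fun i : 'I_N.+1 =>
  if unlift ord_max i is Some j then f j else x.
have app_max f x : app f x ord_max = x by rewrite /app unlift_none.
have app_lift f x j : app f x (lift ord_max j) = f j by rewrite /app liftK.
exists N.+1, (app p s), (app q r); split.
- move=> i; case: (unliftP ord_max i) => [j|] ->; rewrite ?app_max ?app_lift//.
  have [ap [pq qs]] := apq j; split => //; split => //; exact: le_trans sr.
- by move=> i; case: (unliftP ord_max i) => [j|] ->; rewrite ?app_max ?app_lift.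
- move=> i j.
  case: (unliftP ord_max i) => [i'|] ->; case: (unliftP ord_max j) => [j'|] ->;
    rewrite ?app_max ?app_lift ?eqxx// => ij.
  + by apply: dis; apply: contra_neq ij => ->.
  + by left; have [_ []] := apq i'.
  + by right; have [_ []] := apq j'.
- rewrite big_ord_recr/= !app_max; congr (_ + _); apply: eq_bigr => i _.
  have -> : widen_ord (leqnSn N) i = lift ord_max i.
    by apply: val_inj; rewrite /= /bump leqNgt ltn_ord.
  by rewrite !app_lift.
Qed.

End disjoint_increments.

(** * Monotonicity from an almost everywhere bound *)

(** With [d] given by absolute continuity for [e / 2], take [U] of measure below both [d] and
    [e / 2]: the lengths and the increments of [y] then contribute less than [e / 2] each. *)
Lemma ac_disjoint_increment_le {R : realType} {m : nat} (a b : R)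
    (y : R -> 'rV[R]_m.+1) (A : set R) (e : R) :
    absolutely_continuous_on a b y -> (@lebesgue_measure R).-negligible A ->
    0 < e ->
  exists U : set R, [/\ open U, A `<=` U &
    forall v, disjoint_increment U a y b v -> v <= e].
Proof.
move=> yac A0 e0.
have e20 : 0 < e / 2 by rewrite divr_gt0.
have [d d0 yd] := yac _ e20.
have m0 : 0 < Num.min d (e / 2) by rewrite lt_min d0.
have [U [oU AU Ud]] := negligible_open_cover _ _ A0 m0.
exists U; split => // v [N [p [q [apq pqU dis ->]]]].
have := @sum_length_le_measure _ U _ p q (measurable_realfun.open_measurable oU).
move=> /(_ (fun i => (apq i).2.1) pqU dis) /le_lt_trans/(_ Ud).
rewrite lte_fin lt_min => /andP[qpd qpe].
have := yd _ _ _ apq dis qpd; rewrite big_split/=; lra.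
Qed.

(* Real induction on s: up to an arbitrarily small error, G s - G a is bounded
   by e * (s - a) plus L times an increment of y over intervals of U, where U is
   an open set containing the exceptional points. *)
Lemma ac_nonincreasing {R : realType} {m : nat} (a b L : R)
    (y : R -> 'rV[R]_m.+1) (G : R -> R) : a <= b -> 0 <= L ->
    absolutely_continuous_on a b y ->
    {within `[a, b], continuous G} ->
    (forall s, a <= s < b ->
      \forall r \near s^'+, G r - G s <= L * ((r - s) + `|y r - y s|)) ->
    {ae (@lebesgue_measure R), forall s, a <= s < b -> forall e, 0 < e ->
      \forall r \near s^'+, G r - G s <= e * (r - s)} ->
  G b <= G a.
Proof.
move=> ab L0 yac Gcont Glip Gder.
(* The errors collected by the sweep add up to [e * (b - a + L + 1)], which is arbitrarily small. *)
suff GbGa e : 0 < e -> G b <= G a + e * (b - a) + L * e + e.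
  apply/ler_addgt0Pr => e e0.
  have D0 : 0 < b - a + L + 1 by lra.
  have /GbGa : 0 < e / (b - a + L + 1) by rewrite divr_gt0.
  set h := e / _; have : h * (b - a + L + 1) = e by rewrite divfK// gt_eqF.
  by lra.
(* [Gder] unfolds to the negligibility of the set where the derivative bound fails; [U] is an open
   set containing it. *)
move=> e0; have [U [oU AU Ub]] := ac_disjoint_increment_le _ _ _ _ _ yac Gder e0.
(* The arbitrary slack [eta] is what lets [P] pass to a supremum. *)
pose P s := [/\ a <= s, s <= b & forall eta, 0 < eta ->
  exists2 v, disjoint_increment U a y s v &
    G s <= G a + e * (s - a) + L * v + eta].
suff [_ _ /(_ _ e0)[v /Ub ve Gb]] : P b.
  by have := ler_wpM2l L0 ve; lra.
have Pa : P a.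
  split => // eta eta0; exists 0; first exact: (disjoint_increment0 U a y).
  by rewrite subrr !mulr0; lra.
have ubP : ubound [set s | P s] b by move=> s [].
have supP : has_sup [set s | P s] by split; [exists a|exists b].
pose c := sup [set s | P s].
have le_c s : P s -> s <= c by move=> Ps; exact: (sup_upper_bound supP).
have ac : a <= c by exact: le_c.
have cb : c <= b by apply: ge_sup => //; exists a.
(* Half of [eta] pays for the continuity of [G] at [c]; the other half is the slack at a point
   [s <= c] close to [c] where [P] holds. *)
have Pc : P c.
  split => // eta eta0.
  have eta20 : 0 < eta / 2 by rewrite divr_gt0.
  have cab : `[a, b]%classic c by rewrite /= in_itv/= ac cb.
  have /cvgrPdist_lt/(_ _ eta20) := (subspace_continuousP _ _).1 Gcont c cab.
  rewrite /prop_near1 /within /= => -[d /= d0 dG].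
  have [s Ps cds] := sup_adherent d0 supP.
  have [as_ sb /(_ _ eta20)[v vs Gs]] := Ps.
  have sc : s <= c by exact: le_c.
  exists v; first exact: (disjoint_incrementW U a y) vs.
  have : `|G c - G s| < eta / 2.
    apply: dG; last by rewrite in_itv/= as_ sb.
    by rewrite /= ger0_norm ?subr_ge0// ltrBlDl -ltrBlDr.
  have : e * (s - a) <= e * (c - a) by rewrite ler_pM2l// lerD2r.
  by move=> ? /ltr_normlW ?; lra.
have [<-//|cNb] := eqVneq c b.
have {cNb}cb' : c < b by rewrite lt_neqAle cNb.
have [_ _ Pceta] := Pc.
suff [r cr Pr] : exists2 r, c < r & P r.
  by have := le_c _ Pr; rewrite leNgt cr.
(* [P] extends beyond [c]. If [c] is in [U], the interval [[c, r]] joins the family and [Glip]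
   bounds its cost; otherwise the derivative bound holds at [c], and the cost goes into the term
   with factor [e]. *)
have [Uc|NUc] := pselect (U c).
  have [d /= d0 dU] := open_subball oU Uc.
  near c^'+ => r.
  have cr : c < r by near: r; exact: nbhs_right_gt.
  have rb : r <= b by near: r; exact: nbhs_right_le.
  exists r => //; split => //; first exact: le_trans (ltW cr).
  move=> eta /Pceta[v vc Gc].
  exists (v + ((r - c) + `|y r - y c|)).
    apply: disjoint_increment_rcons => //.
    move=> z /=; rewrite in_itv/= => /andP[cz zr].
    have rd : r - c < d / 2 by near: r; apply: nbhs_right_ltDr; rewrite divr_gt0.
    apply: (dU (d / 2)) => /=.
    - by rewrite sub0r normrN gtr0_norm; lra.
    - by rewrite divr_gt0.
    - by rewrite /ball/= distrC ger0_norm; lra.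
  have : G r - G c <= L * ((r - c) + `|y r - y c|).
    by near: r; apply: Glip; rewrite ac.
  have : e * (c - a) <= e * (r - a) by rewrite ler_pM2l// lerD2r ltW.
  by rewrite mulrDr; lra.
near c^'+ => r.
have cr : c < r by near: r; exact: nbhs_right_gt.
have rb : r <= b by near: r; exact: nbhs_right_le.
exists r => //; split => //; first exact: le_trans (ltW cr).
move=> eta /Pceta[v vc Gc].
exists v; first exact: (disjoint_incrementW U a y) (ltW cr) vc.
suff : G r - G c <= e * (r - c) by lra.
near: r.
have : ~ ~ (a <= c < b -> forall e, 0 < e ->
      \forall r \near c^'+, G r - G c <= e * (r - c)).
  by move=> NGc; apply: NUc; exact: AU.
by move/contrapT; apply => //; rewrite ac.
Unshelve. all: by end_near. Qed.

(** * First-order expansions, in general and along a curve *)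

(** This is the little-o remainder of the differential, moved from increments near 0 to points near
    [p]. *)
Lemma near_is_diff {R : realType} {V W : normedModType R} (f df : V -> W)
    (p : V) (e : R) : is_diff p f df -> 0 < e ->
  \forall q \near p, `|f q - f p - df (q - p)| <= e * `|q - p|.
Proof.
move=> fp e0.
have dfE : 'd f p = df :> (V -> W) by exact: diff_val.
have h := diff_locallyx (@ex_diff _ _ _ _ _ _ _ fp).
have : \forall h \near (0 : V), `|f (h + p) - f p - df h| <= e * `|h|.
  near=> k; rewrite h dfE [X in `|X - _|]addrC addrA addKr.
  rewrite [X in `|X - _|]addrC addrK.
  by near: k; exact: littleoP.
move=> h0.
have : \forall q \near p, `|f (q - p + p) - f p - df (q - p)| <= e * `|q - p|.
  have sub0 : q - p @[q --> p] --> (0 : V).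
    by rewrite -(subrr p); apply: cvgB; [exact: cvg_id|exact: cvg_cst].
  exact: (sub0 _ h0).
by apply: filterS => q; rewrite subrK.
Unshelve. all: by end_near. Qed.

Lemma is_derive_is_diff {R : realType} {V : normedModType R} (y : R -> V)
    (s : R) (w : V) :
  is_derive s 1 y w -> is_diff s y (fun h => h *: w).
Proof.
move=> ys; have dys : differentiable y s by exact/derivable1_diffP.
apply: DiffDef => //; rewrite diff1E// derive1E.
by rewrite derive_val.
Qed.

(** The slack [e] absorbs the remainder. This puts a derivative in the form that [ac_nonincreasing]
    asks for almost everywhere. *)
Lemma is_derive_near_right {R : realType} (g : R -> R) (s d e : R) :
  is_derive s 1 g d -> 0 < e ->
  \forall r \near s^'+, g r - g s <= (d + e) * (r - s).
Proof.
move=> /is_derive_is_diff gs e0.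
have h := near_is_diff _ _ _ _ gs e0.
near=> r.
have sr : s < r by near: r; exact: nbhs_right_gt.
have : `|g r - g s - (r - s) *: d| <= e * `|r - s|.
  by near: r; exact: cvg_within h.
rewrite [`|r - s|]gtr0_norm ?subr_gt0// => /(le_trans (ler_norm _)).
by rewrite /GRing.scale/=; lra.
Unshelve. all: by end_near. Qed.

Section along_a_curve.
Context {R : realType} {m : nat}.
Local Notation E := 'rV[R]_m.+1.
Variables (Phi : R -> E -> R) (y : R -> E) (s c : R) (v : E).
Hypothesis dPhi : is_diff ((s, y s) : R * E) (fun p : R * E => Phi p.1 p.2)
  (fun h : R * E => c * h.1 + dotr v h.2).

(** The norm of row vectors is the sup norm, so each of the [m.+1] products is at most the product
    of the norms. *)
Lemma dotr_le (x h : E) : `|dotr x h| <= m.+1%:R * `|x| * `|h|.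
Proof.
rewrite /dotr (le_trans (ler_norm_sum _ _ _))//.
rewrite (le_trans (_ : _ <= \sum_(i < m.+1) `|x| * `|h|))//.
  apply: ler_sum => i _; rewrite normrM.
  have le_mx (z : E) : `|z 0 i| <= `|z|.
    rewrite [in leRHS]/Num.norm/= mx_normrE.
    by rewrite (le_bigmax _ (fun k => `|z k.1 k.2|) (0, i)).
  by rewrite ler_pM.
by rewrite sumr_const card_ord -mulrA mulr_natl.
Qed.

(** The first two terms of the constant bound the differential, and the final 1 covers the
    remainder. Since [y] may fail to have a derivative at [s], this estimate serves at the
    exceptional times. *)
Lemma near_right_lipschitz : {for s, continuous y} ->
  \forall r \near s^'+, `|Phi r (y r) - Phi s (y s)| <=
    (`|c| + m.+1%:R * `|v| + 1) * ((r - s) + `|y r - y s|).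
Proof.
move=> ys.
have h := near_is_diff _ _ _ _ dPhi ltr01.
have {}h : \forall r \near s, `|Phi r (y r) - Phi s (y s)
    - (c * (r - s) + dotr v (y r - y s))| <= 1 * `|(r - s, y r - y s) : R * E|.
  have yy : (r, y r) @[r --> s] --> ((s, y s) : R * E).
    exact: (cvg_pair (f := id) (@cvg_id _ (nbhs s)) ys).
  exact: (yy _ h).
near=> r.
have sr : s < r by near: r; exact: nbhs_right_gt.
have : `|Phi r (y r) - Phi s (y s)
    - (c * (r - s) + dotr v (y r - y s))| <= 1 * `|(r - s, y r - y s) : R * E|.
  by near: r; exact: cvg_within h.
rewrite mul1r prod_normE/= [`|r - s|]gtr0_norm ?subr_gt0// => h1.
have h2 : Num.max (r - s) `|y r - y s| <= (r - s) + `|y r - y s|.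
  by rewrite ge_max lerDl lerDr normr_ge0 subr_ge0 ltW.
have h3 : `|c * (r - s) + dotr v (y r - y s)| <=
    (`|c| + m.+1%:R * `|v|) * ((r - s) + `|y r - y s|).
  rewrite (le_trans (ler_normD _ _))// normrM [`|r - s|]gtr0_norm ?subr_gt0//.
  have := dotr_le v (y r - y s).
  have : 0 <= `|c| * `|y r - y s| by rewrite mulr_ge0.
  have : 0 <= m.+1%:R * `|v| * (r - s).
    by rewrite !mulr_ge0// subr_ge0 ltW.
  lra.
have := lerB_normD (Phi r (y r) - Phi s (y s)) (- (c * (r - s) + dotr v (y r - y s))).
rewrite normrN; lra.
Unshelve. all: by end_near. Qed.

(** Chain rule through the graph of [y], with the factors of the scalar product in the order used by
    [D_uPhi]. *)
Lemma is_derive_along (w : E) : is_derive s 1 y w ->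
  is_derive s 1 (fun r => Phi r (y r)) (c + dotr w v).
Proof.
move=> /is_derive_is_diff yw.
have := @is_diff_comp R R _ _ (fun r => (r, y r) : R * E) _ _ _ s
  (is_diff_pair (is_diff_id s) yw) dPhi.
set g := _ \o _ => dg.
have ddg := @ex_diff _ _ _ _ _ _ _ dg.
have -> : (fun r => Phi r (y r)) = g by [].
apply: DeriveDef; first exact: diff_derivable.
rewrite deriveE// diff_val /= mulr1 scale1r; congr (_ + _).
by apply: eq_bigr => i _; rewrite mulrC.
Qed.

End along_a_curve.

(** * Continuity along absolutely continuous curves *)

Lemma within_continuous_compose {T U W : topologicalType} (A : set T)
    (B : set U) (f : T -> U) (g : U -> W) : f @` A `<=` B ->
    {within A, continuous f} -> {within B, continuous g} ->
  {within A, continuous (g \o f)}.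
Proof.
move=> fAB /subspace_continuousP fc /subspace_continuousP gc.
apply/subspace_continuousP => x Ax.
have Bfx : B (f x) by apply: fAB; exists x.
move=> N /(gc _ Bfx); rewrite /nbhs/= /within/= => hN.
have := fc _ Ax _ hN; rewrite /nbhs/= /within/=.
by apply: filterS => z h Az; apply: h => //; apply: fAB; exists z.
Qed.

Section absolute_continuity.
Context {R : realType} {m : nat}.
Implicit Type y : R -> 'rV[R]_m.+1.

Lemma absolutely_continuous_onS (a b c d : R) y : c <= a -> b <= d ->
  absolutely_continuous_on c d y -> absolutely_continuous_on a b y.
Proof.
move=> ca bd yac e e0; have [r r0 yr] := yac e e0; exists r => // N p q pq.
apply: yr => i; have [ap [pq' qb]] := pq i; split; first exact: le_trans ap.
by split => //; exact: le_trans bd.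
Qed.

(** Continuity is the case of a single interval in the definition of absolute continuity. *)
Lemma ac_within_continuous (a b : R) y :
  absolutely_continuous_on a b y -> {within `[a, b], continuous y}.
Proof.
move=> yac; apply/subspace_continuousP => s; rewrite /= in_itv/= => /andP[as_ sb].
apply/cvgrPdist_lt => e /yac[d d0 yd].
have hd p q : a <= p -> p <= q -> q <= b -> q - p < d -> `|y q - y p| < e.
  move=> ap pq qb qpd.
  have := yd 1%N (fun=> p) (fun=> q) (fun=> conj ap (conj pq qb)).
  by rewrite !big_ord1; apply => // i j; rewrite !ord1.
rewrite /prop_near1 /within /=; exists d => //= r /= srd.
rewrite in_itv/= => /andP[ar rb].
have [sr|/ltW rs] := leP s r.
  by rewrite distrC hd//; move: srd; rewrite distrC ger0_norm ?subr_ge0.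
by rewrite hd//; move: srd; rewrite ger0_norm ?subr_ge0.
Qed.

End absolute_continuity.

Lemma graph_within_continuous {R : realType} {V : topologicalType} (a b : R)
    (y : R -> V) : {within `[a, b], continuous y} ->
  {within `[a, b], continuous (fun s => (s, y s))}.
Proof.
move=> yc; apply/subspace_continuousP => s abs.
have ys := (subspace_continuousP _ _).1 yc s.
have ids : id r @[r --> within `[a, b]%classic (nbhs s)] --> s by exact: cvg_within.
exact: (cvg_pair ids (ys abs)).
Qed.

Lemma within_continuous_along {R : realType} {m : nat} {V : topologicalType}
    (Omega : set 'rV[R]_m.+1) (F : R -> 'rV[R]_m.+1 -> V)
    (y : R -> 'rV[R]_m.+1) (a b : R) :
    {within [set p : R * 'rV[R]_m.+1 | 0 <= p.1 /\ closure Omega p.2],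
      continuous (fun p => F p.1 p.2)} ->
    0 <= a -> {within `[a, b], continuous y} ->
    (forall s, a <= s <= b -> Omega (y s)) ->
  {within `[a, b], continuous (fun s => F s (y s))}.
Proof.
move=> Fc a0 yc yO.
apply: (within_continuous_compose _ _ _ _ _ (graph_within_continuous _ _ _ yc) Fc).
move=> _ [s + <-]; rewrite /= in_itv/= => /andP[as_ sb]; split => /=.
  exact: le_trans as_.
by apply: subset_closure; apply: yO; rewrite as_.
Qed.

(** * Decay of [Phi] along a characteristic *)

(** If [g <= v] occurs at all, [s] is the supremum of the times where it does: continuity gives
    [g s <= v], and [v < g b] forces [s < b]. *)
Lemma last_le {R : realType} (g : R -> R) (a b v : R) :
    {within `[a, b], continuous g} -> a <= b -> v < g b ->
  (forall r, a <= r <= b -> v < g r) \/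
  exists s, [/\ a <= s, s < b, g s <= v & forall r, s < r <= b -> v < g r].
Proof.
move=> gc ab vgb.
have [[r0 Pr0]|NP] := pselect (exists r, [/\ a <= r, r <= b & g r <= v]); last first.
  left => r /andP[ar rb]; rewrite ltNge; apply/negP => grv.
  by apply: NP; exists r.
right; pose S : set R := [set r | [/\ a <= r, r <= b & g r <= v]].
have supS : has_sup S by split; [exists r0|exists b => r []].
have le_sup r : S r -> r <= sup S by move=> Sr; exact: (sup_upper_bound supS).
have as_ : a <= sup S by have [ar _ _] := Pr0; exact: le_trans ar (le_sup _ Pr0).
have sb : sup S <= b by apply: ge_sup => [|r []//]; exists r0.
have gs : g (sup S) <= v.
  rewrite leNgt; apply/negP => vgs.
  have sab : `[a, b]%classic (sup S) by rewrite /= in_itv/= as_ sb.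
  have := (subspace_continuousP _ _).1 gc _ sab.
  move=> /cvgrPdist_lt/(_ (g (sup S) - v)); rewrite subr_gt0 => /(_ vgs).
  rewrite /prop_near1 /within /= => -[d /= d0 dg].
  have [r Sr sdr] := sup_adherent d0 supS.
  have [ar rb grv] := Sr; have rs := le_sup _ Sr.
  have : `|g (sup S) - g r| < g (sup S) - v.
    apply: dg; last by rewrite in_itv/= ar rb.
    by rewrite /= ger0_norm ?subr_ge0// ltrBlDl -ltrBlDr.
  by move=> /ltr_normlW; lra.
exists (sup S); split => //.
  by rewrite lt_neqAle sb andbT; apply: contraTneq vgb => <-; rewrite -leNgt.
move=> r /andP[sr rb]; rewrite ltNge; apply/negP => grv.
have Sr : S r by split => //; apply: le_trans (ltW sr).
by have := le_sup _ Sr; rewrite leNgt sr.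
Qed.

(** [ac_nonincreasing] is applied to [G s = Phi s (y s) + gamma * s]. As [Phi] is differentiable
    only at positive times and [a] may be 0, this is done on [[a', b]] with [a < a'], and then [a']
    tends to [a]. *)
Lemma decay_along_curve {R : realType} {m : nat} (Omega : set 'rV[R]_m.+1)
    (Phi dtPhi : R -> 'rV[R]_m.+1 -> R)
    (gradPhi u : R -> 'rV[R]_m.+1 -> 'rV[R]_m.+1)
    (y : R -> 'rV[R]_m.+1) (a b gamma : R) :
    C1_closed Omega Phi dtPhi gradPhi -> 0 <= a -> a < b ->
    absolutely_continuous_on a b y ->
    (forall s, a <= s <= b -> Omega (y s)) ->
    {ae (@lebesgue_measure R), forall s : R, 0 < s -> is_derive s 1 y (u s (y s))} ->
    (forall s, a < s < b ->
      dtPhi s (y s) + dotr (u s (y s)) (gradPhi s (y s)) <= - gamma) ->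
  Phi b (y b) <= Phi a (y a) - gamma * (b - a).
Proof.
move=> Phi1 a0 ab yac yO yder decay.
have yc := ac_within_continuous _ _ _ yac.
pose g s := Phi s (y s).
have gc : {within `[a, b], continuous g}.
  exact: within_continuous_along (C1_cont Phi1) a0 yc yO.
(* [ell s] is the constant of [near_right_lipschitz]. It is continuous on [[a, b]], and its maximum,
   increased by the absolute value of [gamma] for the term [gamma * s], gives a uniform [L]. *)
pose ell s := `|dtPhi s (y s)| + m.+1%:R * `|gradPhi s (y s)| + 1.
have ellc : {within `[a, b], continuous ell}.
  have /subspace_continuousP dtc :=
    within_continuous_along _ _ _ _ _ (C1_dt_cont Phi1) a0 yc yO.
  have /subspace_continuousP grc :=
    within_continuous_along _ _ _ _ _ (C1_grad_cont Phi1) a0 yc yO.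
  apply/subspace_continuousP => s abs.
  apply: cvgD; last exact: cvg_cst.
  apply: cvgD; first by apply: cvg_norm; exact: dtc.
  by apply: cvgMr; apply: cvg_norm; exact: grc.
have [c _ ellM] := EVT_max (ltW ab) ellc.
pose L := ell c + `|gamma|.
have L0 : 0 <= L by rewrite /L /ell !addr_ge0// mulr_ge0.
pose G s := g s + gamma * s.
have Gc : {within `[a, b], continuous G}.
  move: gc => /subspace_continuousP gc; apply/subspace_continuousP => s abs.
  apply: cvgD; first exact: gc.
  by apply: cvgMr; exact: cvg_within.
have dPhi s : a < s < b -> is_diff ((s, y s) : R * 'rV[R]_m.+1)
    (fun p => Phi p.1 p.2)
    (fun h => dtPhi s (y s) * h.1 + dotr (gradPhi s (y s)) h.2).
  move=> /andP[as_ sb]; apply: (C1_diff Phi1); first exact: le_lt_trans as_.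
  by apply: yO; rewrite !ltW.
have Gmono a' : a < a' < b -> G b <= G a'.
  move=> /andP[aa' a'b].
  apply: (ac_nonincreasing a' b L y) => //; first exact: ltW.
  - exact: absolutely_continuous_onS (ltW aa') (lexx b) yac.
  - apply: continuous_subspaceW Gc; apply: subset_itvr; rewrite bnd_simp; exact: ltW.
  - move=> s /andP[a's sb]; have asb : a < s < b by rewrite sb (lt_le_trans aa').
    have hs := near_right_lipschitz _ _ _ _ _ (dPhi _ asb)
      (within_continuous_continuous ab yc asb).
    near=> r.
    have sr : s < r by near: r; exact: nbhs_right_gt.
    have : `|g r - g s| <= ell s * ((r - s) + `|y r - y s|).
      by near: r; exact: hs.
    have : ell s <= ell c.
      by apply: ellM; rewrite in_itv/= !ltW//; case/andP: asb.
    rewrite -subr_ge0 => lsc /(le_trans (ler_norm _)) hgs.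
    have rs0 : 0 <= (r - s) + `|y r - y s| by rewrite addr_ge0// subr_ge0 ltW.
    have := mulr_ge0 lsc rs0.
    have : gamma * (r - s) <= `|gamma| * (r - s).
      by rewrite ler_wpM2r ?ler_norm// subr_ge0 ltW.
    have : 0 <= `|gamma| * `|y r - y s| by rewrite mulr_ge0.
    by rewrite /G /L; lra.
  (* Wherever [y] satisfies its differential equation, [g] has the derivative [dd <= - gamma], so
     the exceptional times for [G] are among those for [y]. *)
  - apply: negligibleS yder => s; apply: contra_not => ys /andP[a's sb] e e0.
    have asb : a < s < b by rewrite sb (lt_le_trans aa').
    have s0 : 0 < s by case/andP: asb => + _; exact: le_lt_trans.
    have hs := is_derive_near_right _ _ _ _
      (is_derive_along _ _ _ _ _ (dPhi _ asb) _ (ys s0)) e0.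
    have := decay _ asb; set dd := _ + dotr _ _ in hs * => hdd.
    near=> r.
    have sr : s < r by near: r; exact: nbhs_right_gt.
    have : g r - g s <= (dd + e) * (r - s) by near: r; exact: hs.
    have : (dd + gamma) * (r - s) <= 0.
      by apply: mulr_le0_ge0; [lra|rewrite subr_ge0 ltW].
    by rewrite /G; lra.
suff : G b <= G a by rewrite /G /g; lra.
apply/ler_addgt0Pr => e e0.
have aab : `[a, b]%classic a by rewrite /= in_itv/= lexx ltW.
have := (subspace_continuousP _ _).1 Gc _ aab.
move=> /cvgrPdist_lt/(_ _ e0); rewrite /prop_near1 /within /= => -[d /= d0 Ga].
near a^'+ => a'.
have aa' : a < a' by near: a'; exact: nbhs_right_gt.
have a'b : a' < b by near: a'; exact: nbhs_right_lt.
have : `|G a - G a'| < e.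
  apply: Ga; last by rewrite in_itv/= !ltW.
  rewrite /= distrC ger0_norm ?subr_ge0 ?ltW//.
  by near: a'; exact: nbhs_right_ltDr.
have := Gmono a'; rewrite aa' a'b => /(_ isT).
by rewrite ltr_distlC; lra.
Unshelve. all: by end_near. Qed.

(** * Lower bound for the integral of [sigma] along a curve *)

(** Shrinking the domain to [[c, b]] drops a nonnegative part, and there [f] dominates the constant
    [v]. The bound [M] gives integrability, so the real-valued integrals compared come from finite
    ones. *)
Lemma mul_length_le_Rintegral {R : realType} (f : R -> R) (M a b c v : R) :
    a <= c <= b -> measurable_fun `[a, b] f ->
    (forall s, s \in `[a, b] -> 0 <= f s <= M) ->
    (forall s, s \in `[c, b] -> v <= f s) ->
  v * (b - c) <= \int[@lebesgue_measure R]_(s in `[a, b]) f s.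
Proof.
move=> /andP[ac cb] mf fM vf.
have itv_fin x y : (@lebesgue_measure R `[x, y]%classic < +oo)%E.
  by rewrite lebesgue_measure_itv/=; case: ifP => _; rewrite ?ltry.
have sub : `[c, b]%classic `<=` (`[a, b]%classic : set R).
  by apply: subset_itvr; rewrite bnd_simp.
have intf : (@lebesgue_measure R).-integrable `[a, b] (EFin \o f).
  apply: (measurable_bounded_integrable _ (itv_fin _ _)) => //.
  exists M; split; first exact: num_real.
  move=> M' MM' s /fM/andP[fs0 fsM] /=; rewrite ger0_norm//.
  exact: le_trans (ltW MM').
have intf' : (@lebesgue_measure R).-integrable `[c, b] (EFin \o f).
  by apply: integrableS intf.
apply: (@le_trans _ _ (\int[@lebesgue_measure R]_(s in `[c, b]) f s)).
  rewrite (_ : v * _ =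
      \int[@lebesgue_measure R]_(s in `[c, b]) (cst v s)).
    apply: le_Rintegral => //.
      apply: (measurable_bounded_integrable _ (itv_fin _ _)) => //.
      exact: bounded_cst.
  rewrite Rintegral_cst//; congr (_ * _).
  rewrite [X in fine X]lebesgue_measure_itv/= lte_fin.
  by case: ltP => //= bc; apply/eqP; rewrite subr_eq0 eq_le bc.
apply: fine_le.
- exact: integrable_fin_num intf'.
- exact: integrable_fin_num intf.
- apply: ge0_subset_integral => //.
  + by case/integrableP : intf.
  + by move=> s /fM/andP[fs0 _]; rewrite lee_fin.
Qed.

(** A Borel function composed with the continuous map [s |-> (s, y s)] is Borel. For a merely
    Lebesgue measurable [sigma] measurability could be lost, hence the Borel representative. *)
Lemma localization_measurable_along {R : realType} {m : nat}
    (Omega : set 'rV[R]_m.+1) (sigma : R -> 'rV[R]_m.+1 -> R)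
    (y : R -> 'rV[R]_m.+1) (a b : R) :
    open Omega -> localization Omega sigma -> 0 <= a ->
    {within `[a, b], continuous y} ->
    (forall s, a <= s <= b -> Omega (y s)) ->
  measurable_fun `[a, b] (fun s => sigma s (y s)).
Proof.
move=> oO [msig _] a0 yc yO.
pose B := g_sigma_algebraType (@open (R * 'rV[R]_m.+1)%type).
pose D := [set p : R * 'rV[R]_m.+1 | 0 <= p.1 /\ Omega p.2].
pose z s : R * 'rV[R]_m.+1 := (s, y s).
have zc := graph_within_continuous _ _ _ yc.
have openB (A : set (R * 'rV[R]_m.+1)) : open A -> measurable (A : set B).
  by move=> oA; exact: sub_sigma_algebra.
have mD : measurable (D : set B).
  have -> : D = (~` (fst @^-1` [set r : R | r < 0])) `&` (snd @^-1` Omega).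
    apply/seteqP; split=> -[r x] [/= r0 Ox]; split => //=.
      by rewrite ltNge r0.
    by rewrite leNgt; exact/negP.
  apply: measurableI.
    apply: measurableC; apply: openB; apply: open_comp; last exact: open_lt.
    by move=> p _; exact: cvg_fst.
  apply: openB; apply: open_comp => // p _; exact: cvg_snd.
have mz : measurable_fun (`[a, b]%classic : set R) (z : R -> B).
  apply: (@measurability _ _ _ B _ z (@open (R * 'rV[R]_m.+1)%type)) => //.
  move=> _ [A oA <-].
  (* Continuity within [[a, b]] makes the preimage of [A] there the trace of an open set [V] of the
     line. *)
  have /open_subspaceP[V oV VA] := (continuousP _).1 zc _ oA.
  rewrite setIC -VA; apply: measurableI; last exact: measurable_itv.
  exact: measurable_realfun.open_measurable.
apply: (measurable_comp mD _ msig mz).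
move=> _ [s + <-]; rewrite /= in_itv/= => abs.
by split; [case/andP: abs => + _; exact: le_trans|exact: yO].
Qed.

(** * Uniform entry into [V_d] and the resulting integral bound *)

Theorem mainTheorem2 (R : realType) (m : nat)
  (Omega : set 'rV[R]_m.+1) (n : 'rV[R]_m.+1 -> 'rV[R]_m.+1)
  (hOmega : bounded_domain Omega) (hC2 : C2_boundary Omega)
  (hn : outward_unit_normal Omega n)
  (u : R -> 'rV[R]_m.+1 -> 'rV[R]_m.+1) (hu : velocity_field Omega n u)
  (sigma : R -> 'rV[R]_m.+1 -> R) (hsigma : localization Omega sigma)
  (X : R -> R -> 'rV[R]_m.+1 -> 'rV[R]_m.+1)
  (hX : characteristic_flow Omega u X)
  (K : R -> set 'rV[R]_m.+1)
  (hKOmega : forall t : R, 0 <= t -> K t `<=` Omega)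
  (hKmeas : forall t : R, 0 <= t -> lebesgue_measurable (K t))
  (hKinv : forall s t : R, 0 <= s -> s <= t -> X t s @` K s `<=` K t)
  (Phi dtPhi : R -> 'rV[R]_m.+1 -> R) (gradPhi : R -> 'rV[R]_m.+1 -> 'rV[R]_m.+1)
  (hPhi : C1_closed Omega Phi dtPhi gradPhi)
  (a_d : R) :
  let V_d (t : R) := [set x | Omega x /\ Phi t x <= a_d] in
  let D_uPhi (t : R) (x : 'rV[R]_m.+1) := dtPhi t x + dotr (u t x) (gradPhi t x) in
  forall (hV : forall t : R, 0 <= t -> V_d t !=set0)
    (gamma Phi_max sigma_min : R)
    (hgamma : 0 < gamma) (hPhi_max : a_d < Phi_max)
    (hsigma_min : 0 < sigma_min)
    (hbound : forall (t : R) (x : 'rV[R]_m.+1), 0 <= t -> K t x -> Phi t x <= Phi_max)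
    (hdecay : forall (t : R) (x : 'rV[R]_m.+1), 0 <= t -> (K t `\` V_d t) x -> D_uPhi t x <= - gamma)
    (hlower : forall (t : R) (x : 'rV[R]_m.+1), 0 <= t -> (V_d t `&` K t) x -> sigma_min <= sigma t x),
  let T_in := (Phi_max - a_d) / gamma in
  (forall (t : R) (x : 'rV[R]_m.+1), 0 <= t -> K t x ->
    forall s : R, t + T_in <= s -> (V_d s `&` K s) (X s t x)) /\
  (forall T : R, T_in < T -> forall (t : R) (x : 'rV[R]_m.+1), 0 <= t -> K t x ->
    sigma_min * (T - T_in) <=
      \int[@lebesgue_measure R]_(s in `[t, t + T]) sigma s (X s t x)).
Proof.
move=> V_d D_uPhi hV gamma Phi_max sigma_min hgamma hPhi_max hsigma_min
  hbound hdecay hlower T_in.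
have Tin0 : 0 < T_in by rewrite divr_gt0// subr_gt0.
have oO : open Omega by case: hOmega.
(* Forward invariance keeps the characteristic in [K], where the hypotheses on [Phi] and [sigma]
   apply. *)
have XK t x s : 0 <= t -> K t x -> t <= s -> K s (X s t x).
  by move=> t0 Kx ts; apply: (hKinv t s) => //; exists x.
have XO t x s : 0 <= t -> K t x -> t <= s -> Omega (X s t x).
  by move=> t0 Kx ts; apply: (hKOmega s); [exact: le_trans ts|exact: XK].
have Xac t x a b : 0 <= t -> K t x -> 0 <= a -> a <= b ->
    absolutely_continuous_on a b (fun s => X s t x).
  move=> t0 Kx; apply: (cf_ac hX) => //.
  by apply: subset_closure; exact: hKOmega Kx.
have enter t x : 0 <= t -> K t x ->
    forall s, t + T_in <= s -> Phi s (X s t x) <= a_d.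
  move=> t0 Kx s1 ts1; rewrite leNgt; apply/negP => gs1.
  have ts1' : t < s1 by lra.
  (* While [Phi] exceeds [a_d], the characteristic is in [K] minus [V_d], so [hdecay] applies on the
     whole open stretch from [a] to [s1]. *)
  have decay a : t <= a -> a < s1 ->
      (forall r, a < r < s1 -> a_d < Phi r (X r t x)) ->
      Phi s1 (X s1 t x) <= Phi a (X a t x) - gamma * (s1 - a).
    move=> ta as1 above.
    have a0 : 0 <= a by exact: le_trans ta.
    apply: (decay_along_curve _ _ _ _ u (fun s => X s t x) _ _ _ hPhi) => //.
    - by apply: Xac => //; exact: ltW.
    - by move=> s /andP[as_ _]; apply: XO => //; exact: le_trans as_.
    - by apply: (cf_ode hX) => //; apply: subset_closure; exact: hKOmega Kx.
    - move=> s /andP[as_ ss1]; have ts : t <= s by exact: le_trans (ltW as_).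
      apply: hdecay; first exact: le_trans ts.
      split; first exact: XK.
      by move=> [_]; rewrite leNgt above// as_.
  have gc : {within `[t, s1], continuous (fun s => Phi s (X s t x))}.
    apply: (within_continuous_along _ _ (fun s => X s t x) _ _ (C1_cont hPhi) t0).
      by apply: ac_within_continuous; apply: Xac => //; exact: ltW.
    by move=> s /andP[ts _]; exact: XO.
  (* If the value stays above [a_d] from time [t] on, it loses at least
     [gamma * T_in = Phi_max - a_d] from a start of at most [Phi_max]. Otherwise it falls strictly
     from a value at most [a_d] at the last time [s0]. Both contradict [gs1]. *)
  have [above|[s0 [ts0 s0s1 gs0 above]]] := last_le _ _ _ _ gc (ltW ts1') gs1.
    have := decay t (lexx _) ts1'.
    rewrite (cf_init hX)//; last by apply: subset_closure; exact: hKOmega Kx.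
    have := hbound _ _ t0 Kx.
    have : gamma * T_in <= gamma * (s1 - t) by rewrite ler_pM2l//; lra.
    have -> : gamma * T_in = Phi_max - a_d by rewrite mulrC divfK// gt_eqF.
    move=> h1 h2 /(_ _)/wrap[|h3]; last by lra.
    by move=> r /andP[tr rs]; apply: above; rewrite !ltW.
  have := decay s0 ts0 s0s1.
  have : 0 < gamma * (s1 - s0) by rewrite mulr_gt0// subr_gt0.
  move=> h1 /(_ _)/wrap[|h3]; last by lra.
  by move=> r /andP[tr rs]; apply: above; rewrite tr ltW.
split.
  move=> t x t0 Kx s ts; have tls : t <= s by lra.
  split; last exact: XK.
  by split; [exact: XO|exact: enter].
move=> T TinT t x t0 Kx.
pose f s := sigma s (X s t x).
have mf : measurable_fun `[t, t + T] f.
  apply: (localization_measurable_along Omega _ (fun s => X s t x)) => //.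
    by apply: ac_within_continuous; apply: Xac => //; move: Tin0 TinT; lra.
  by move=> s /andP[ts _]; exact: XO.
have [_ [M sigM]] := hsigma.
(* The right-hand side is the length of the interval after entry, on which [sigma] is at least
   [sigma_min]. *)
have -> : T - T_in = (t + T) - (t + T_in) by lra.
apply: (@mul_length_le_Rintegral _ f M) => //.
- by rewrite lerDl ltW// lerD2l ltW.
- move=> s; rewrite in_itv/= => /andP[ts _].
  by apply: sigM; [exact: le_trans ts|exact: XO].
- move=> s; rewrite in_itv/= => /andP[ts _].
  have tls : t <= s by lra.
  apply: hlower; first exact: le_trans tls.
  by split; [split; [exact: XO|exact: enter]|exact: XK].
Qed.
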